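(* Let $n$ be a positive integer and let $(\infty,B)$ be a generic axis-aligned $n$-gon such that $T_1^{n-1}$ is defined on $(\infty,B)$, where $T_1$ is the lower pentagram map. Then $T_1^{n-1}(\infty,B)=(C,D)$, where $D=(d_1,d_2,\dots,d_n)$ satisfies $$d_1=d_2=\cdots=d_n=\mathscr C(B).$$
   Context: $\mathbb{P}^1=\mathbb{R}\cup\{\infty\}$ is the real projective line; a polygon ($n$-gon) in $\mathbb{P}^1$ is a cyclically labelled $n$-tuple of points (indices mod $n$). For six points put $$[a,b,c,d,e,f]=\frac{(a-b)(c-d)(e-f)}{(b-c)(d-e)(f-a)} ,$$ extended to $\mathbb{P}^1$ in the usual projective way (replace each difference $u-v$ by the $2\times 2$ determinant of homogeneous coordinates of $u$ and $v$). The lower pentagram map $T_1$ takes a pair of $n$-gons $(X,Y)$ in $\mathbb{P}^1$ to the pair $(Y,Z)$, where $Z=(Z_1,\dots,Z_n)$ and $Z_i$ is the unique point of $\mathbb{P}^1$ with $$[X_i,Y_i,Y_{i-1},Z_i,Y_i,Y_{i+1}]=-1$$ (indices mod $n$); it is defined when such unique points exist. An axis-aligned $n$-gon $(\infty,B)$ is a pair whose first entry is the $n$-tuple $(\infty,\dots,\infty)$ and whose second entry is $B=(B_1,\dots,B_n)\in\mathbb{R}^n\subset(\mathbb{P}^1)^n$. Its center of mass is $\mathscr C(B)=\frac1n(B_1+\cdots+B_n)$. ''Generic'' means: for all $B$ in some nonempty Zariski-open subset of $\mathbb{R}^n$. *)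

(* Defs.v *)
From mathcomp Require Import all_boot all_order all_algebra.
From mathcomp Require Import boolp classical_sets reals.
From mathcomp Require Import mpoly.

Set Implicit Arguments.
Unset Strict Implicit.
Unset Printing Implicit Defensive.

Import Order.TTheory GRing.Theory Num.Theory.
Local Open Scope ring_scope.

(* The real projective line R u {oo}; [None] is the point oo. *)
Definition proj_line (R : realType) : Type := option R.

Definition p_infty {R : realType} : proj_line R := None.

Definition p_fin {R : realType} (x : R) : proj_line R := Some x.

Definition hcoord {R : realType} (u : proj_line R) : 'rV[R]_2 :=
  if u is Some x then \row_(j < 2) (if j == 0 then x else 1)
  else \row_(j < 2) (if j == 0 then 1 else 0).

(* Projective substitute for the difference u - v, see [pdiff_fin]. *)
Definition pdiff {R : realType} (u v : proj_line R) : R :=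
  \det (col_mx (hcoord u) (hcoord v) : 'M[R]_2).

(* Each point occurs exactly once above and once below the fraction bar, so the
   value does not depend on the homogeneous coordinates chosen in [hcoord].
   Since division by 0 yields 0 here, an equation [multiratio _ _ _ _ _ _ = -1]
   holds only if the denominator is nonzero, i.e. if the multi-ratio is a
   genuine finite value. *)
Definition multiratio {R : realType} (a b c d e f : proj_line R) : R :=
  (pdiff a b * pdiff c d * pdiff e f) / (pdiff b c * pdiff d e * pdiff f a).

Definition polygon (R : realType) (n : nat) : Type := {ffun 'I_n -> proj_line R}.

Section LowerPentagram.
Variables (R : realType) (n : nat).
Implicit Types X Y Z : polygon R n.

Definition pentagram_point X Y (i : 'I_n) (z : proj_line R) : Prop :=
  multiratio (X i) (Y i) (Y (ord_pred i)) z (Y i) (Y (ordS i)) = -1.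

(* [None] means that the map is undefined at the given pair. *)
Definition lower_pentagram (XY : polygon R n * polygon R n) :
    option (polygon R n * polygon R n) :=
  if pselect (forall i, exists! z, pentagram_point XY.1 XY.2 i z) is left h
  then Some (XY.2, [ffun i => sval (cid (h i))])
  else None.

Definition lower_pentagram_iter (k : nat) (XY : polygon R n * polygon R n) :
    option (polygon R n * polygon R n) :=
  iter k (obind lower_pentagram) (Some XY).

Definition axis_aligned (B : 'I_n -> R) : polygon R n * polygon R n :=
  ([ffun=> p_infty], [ffun i => p_fin (B i)]).

Definition center_of_mass (B : 'I_n -> R) : R := n%:R^-1 * \sum_(i < n) B i.

Definition zariski_closed (A : set ('I_n -> R)) : Prop :=
  exists S : set {mpoly R[n]}, A = [set x | forall p, S p -> p.@[x] = 0]%classic.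

Definition zariski_open (U : set ('I_n -> R)) : Prop := zariski_closed (~` U)%classic.

Definition generically (P : ('I_n -> R) -> Prop) : Prop :=
  exists U : set ('I_n -> R),
    [/\ zariski_open U, (U !=set0)%classic & forall B, U B -> P B].

End LowerPentagram.

Lemma pdiffE (R : realType) (u v : proj_line R) :
  pdiff u v = hcoord u 0 0 * hcoord v 0 1 - hcoord u 0 1 * hcoord v 0 0.
Proof.
rewrite /pdiff (expand_det_row _ ord0) !big_ord_recl big_ord0 addr0.
rewrite /cofactor !det_mx11 !mxE.
have -> : split (ord0 : 'I_(1 + 1)) = inl 0.
  by rewrite -[RHS]unsplitK; congr split; apply: val_inj.
have -> : split (lift ord0 0 : 'I_(1 + 1)) = inr 0.
  by rewrite -[RHS]unsplitK; congr split; apply: val_inj.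
have -> : lift ord0 ord0 = 1 :> 'I_2 by apply: val_inj.
have -> : lift 1 0 = 0 :> 'I_2 by apply: val_inj.
by rewrite expr0 expr1 mul1r mulN1r mulrN.
Qed.

Lemma pdiff_fin (R : realType) (x y : R) : pdiff (p_fin x) (p_fin y) = x - y.
Proof. by rewrite pdiffE !mxE /= mulr1 mul1r. Qed.

Lemma pdiff_infty_fin (R : realType) (y : R) : pdiff p_infty (p_fin y) = 1.
Proof. by rewrite pdiffE !mxE /= mulr1 mul0r subr0. Qed.

Lemma pdiff_fin_infty (R : realType) (x : R) : pdiff (p_fin x) p_infty = -1.
Proof. by rewrite pdiffE !mxE /= mulr0 mul1r sub0r. Qed.

Lemma lower_pentagramP (R : realType) (n : nat) (X Y C D : polygon R n) :
  lower_pentagram (X, Y) = Some (C, D) <->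
  C = Y /\ forall i, unique (pentagram_point X Y i) (D i).
Proof.
rewrite /lower_pentagram; case: pselect => [h|nh]; split=> //=.
- case=> <- <-; split=> // i; rewrite ffunE; exact: svalP.
- case=> -> uD; congr (Some (_, _)); apply/ffunP => i; rewrite ffunE.
  by case: cid => z /= uz; apply: uz.2; have [] := uD i.
- by case=> _ uD; case: nh => i; exists (D i).
Qed.

(* Main.v *)
(** In homogeneous coordinates, with [<p, q>] the 2x2 determinant, the polygon
    reached after k steps has vertices [P(k, m)] (in position m + k), where
    [P(0, m) = (B_m, 1)] and, for [w(k, m) = <P(k, m), P(k, m+1)>],
      [P(k+1, m) = P(k, m+1) - (w(k, m+1) / w(k, m)) P(k, m)];
    the multi-ratio equation is then an identity between the w's.
    The same recursion, run on polynomials with a factor 'X in the first term,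
    gives monic c(k, m) of degree k with
      [P(k, m) = ((c(k, m)(E) B)_m, c(k, m)(1))],  E the shift operator,
    and [c(k, m)(E) B] is constant on the positions m, ..., m + k: the step from
    k to k + 1 holds because w(k, m) is, up to sign, the first jump of
    [c(k, m)(E) B], as one sees by computing [c(k, m+1)(E) c(k, m)(E) B]
    in both orders.  For k = n - 1 the constancy covers a whole period, and
    summing over it identifies the constant with c(1) times the mean of B.
    (This is the exactness of the Shanks transform; the multi-ratio equation is
    Wynn's cross rule.) *)

Require Import Defs.
From mathcomp Require Import all_boot all_order all_algebra.
From mathcomp Require Import boolp classical_sets reals.
From mathcomp Require Import mpoly.
From mathcomp Require Import ring.

Set Implicit Arguments.
Unset Strict Implicit.
Unset Printing Implicit Defensive.

Import GRing.Theory Num.Theory.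
Local Open Scope ring_scope.

(** * Polynomials in the shift operator acting on sequences *)

Section ShiftOperator.
Variable R : comNzRingType.
Implicit Types (p q : {poly R}) (s : nat -> R).

Definition shift_act p s (l : nat) : R := \sum_(j < size p) p`_j * s (l + j)%N.

Lemma shift_act_wide N p s l : (size p <= N)%N ->
  shift_act p s l = \sum_(j < N) p`_j * s (l + j)%N.
Proof.
move=> le_pN; rewrite /shift_act (big_ord_widen N (fun j => p`_j * s (l + j)%N)) //.
rewrite big_mkcond; apply: eq_bigr => j _; case: ltnP => // le_pj.
by rewrite nth_default ?mul0r.
Qed.

Lemma shift_actD p q s l :
  shift_act (p + q) s l = shift_act p s l + shift_act q s l.
Proof.
rewrite !(@shift_act_wide (maxn (size p) (size q))) ?leq_maxl ?leq_maxr ?size_polyD //.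
by rewrite -big_split; apply: eq_bigr => j _; rewrite coefD mulrDl.
Qed.

Lemma shift_actZ a p s l : shift_act (a *: p) s l = a * shift_act p s l.
Proof.
rewrite (@shift_act_wide (size p)) ?size_scale_leq // mulr_sumr.
by apply: eq_bigr => j _; rewrite coefZ mulrA.
Qed.

Lemma shift_actMX p s l : shift_act (p * 'X) s l = shift_act p s l.+1.
Proof.
rewrite (@shift_act_wide (size p).+1); last first.
  by rewrite (leq_trans (size_polyMleq _ _)) // size_polyX addn2.
rewrite big_ord_recl coefMX mul0r add0r; apply: eq_bigr => j _.
by rewrite coefMX /= addSnnS.
Qed.

Lemma shift_actC a s l : shift_act a%:P s l = a * s l.
Proof.
by rewrite (@shift_act_wide 1) ?size_polyC_leq1 // big_ord1 coefC addn0.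
Qed.

(** Multiplicativity turns commutativity of polynomials into commutation of the operators, which is
    what allows a composite to be computed in two orders. *)
Lemma shift_actM p q s l : shift_act (p * q) s l = shift_act p (shift_act q s) l.
Proof.
elim/poly_ind: p l => [|p a IHp] l.
  by rewrite mul0r -[0]/(0%:P) !shift_actC !mul0r.
rewrite mulrDl -mulrA ['X * q]mulrC mulrA !shift_actD !shift_actMX IHp.
by rewrite mul_polyC shift_actZ shift_actC.
Qed.

(** On a constant sequence the operator multiplies by [p.[1]]; the deviation at the last position
    meets only the leading coefficient, which is 1. *)
Lemma shift_act_const_but_last k p s l a : p \is monic -> size p = k.+1 ->
    (forall j, (j < k)%N -> s (l + j)%N = a) ->
  shift_act p s l = a * p.[1] + (s (l + k)%N - a).
Proof.
move=> p_monic sz_p s_const.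
have p_k : p`_k = 1 by move/monicP: p_monic; rewrite lead_coefE sz_p.
rewrite horner_coef /shift_act sz_p !big_ord_recr /= p_k.
under eq_bigr => j _ do rewrite s_const // mulrC.
under [in RHS]eq_bigr => j _ do rewrite expr1n mulr1.
by rewrite -mulr_sumr expr1n; ring.
Qed.

End ShiftOperator.

(** * The recursion on homogeneous points and the exactness of the Shanks transform *)

Section ShanksTransform.
Variable F : fieldType.
Variable s : nat -> F.

Definition det2 (p q : F * F) : F := p.1 * q.2 - p.2 * q.1.

(** Both coordinates are values of the operator [c m]: on [s], and on the constant sequence 1. *)
Definition hpoint_of (c : nat -> {poly F}) (m : nat) : F * F :=
  (shift_act (c m) s m, (c m).[1]).

Fixpoint shanks_poly (k m : nat) : {poly F} :=
  if k is k'.+1 then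
    let w i := det2 (hpoint_of (shanks_poly k') i)
                    (hpoint_of (shanks_poly k') i.+1) in
    shanks_poly k' m.+1 * 'X - (w m.+1 / w m) *: shanks_poly k' m
  else 1.
Arguments shanks_poly : simpl never.

Definition shanks_point k m : F * F := hpoint_of (shanks_poly k) m.
Definition shanks_det k m := det2 (shanks_point k m) (shanks_point k m.+1).

Lemma shanks_polyS k m : shanks_poly k.+1 m = shanks_poly k m.+1 * 'X
  - (shanks_det k m.+1 / shanks_det k m) *: shanks_poly k m.
Proof. by []. Qed.

Lemma size_shanks_poly_monic k m :
  size (shanks_poly k m) = k.+1 /\ shanks_poly k m \is monic.
Proof.
elim: k m => [|k IHk] m; first by rewrite size_poly1 monic1.
have [sz1 mon1] := IHk m.+1; have [sz0 _] := IHk m.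
have sz1X : size (shanks_poly k m.+1 * 'X) = k.+2.
  by rewrite size_mulX ?sz1 // -size_poly_gt0 sz1.
have lt_sz : (size (- ((shanks_det k m.+1 / shanks_det k m) *: shanks_poly k m))
              < size (shanks_poly k m.+1 * 'X)%R)%N.
  by rewrite size_polyN sz1X ltnS (leq_trans (size_scale_leq _ _)) ?sz0.
rewrite shanks_polyS size_polyDl // sz1X; split=> //.
by rewrite monicE lead_coefDl // lead_coefMX -monicE.
Qed.

Lemma shift_act_shanks_polyS k m l : shift_act (shanks_poly k.+1 m) s l =
  shift_act (shanks_poly k m.+1) s l.+1
  - shanks_det k m.+1 / shanks_det k m * shift_act (shanks_poly k m) s l.
Proof. by rewrite shanks_polyS -scaleNr shift_actD shift_actMX shift_actZ mulNr. Qed.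

Definition shanks_const k := forall m j, (j <= k)%N ->
  shift_act (shanks_poly k m) s (m + j) = shift_act (shanks_poly k m) s m.

Lemma shanks_jump k m : shanks_const k ->
  shift_act (shanks_poly k m) s (m + k.+1) - shift_act (shanks_poly k m) s m =
  - shanks_det k m.
Proof.
move=> s_const.
have [sz0 mon0] := size_shanks_poly_monic k m.
have [sz1 mon1] := size_shanks_poly_monic k m.+1.
set a0 := shift_act (shanks_poly k m) s m.
set a1 := shift_act (shanks_poly k m.+1) s m.+1.
(* The positions read, m + 1 to m + 1 + k, all lie where the inner sequence is constant, so the
   deviation vanishes. *)
have act01 : shift_act (shanks_poly k m) (shift_act (shanks_poly k m.+1) s) m.+1 =
    a1 * (shanks_poly k m).[1].
  rewrite (@shift_act_const_but_last _ k _ _ _ a1) //; last first.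
    by move=> j /ltnW le_jk; rewrite s_const.
  by rewrite s_const // subrr addr0.
(* In the other order the positions read overshoot the constant range m to m + k by one, and the
   jump appears with weight 1. *)
have act10 : shift_act (shanks_poly k m.+1) (shift_act (shanks_poly k m) s) m.+1 =
    a0 * (shanks_poly k m.+1).[1] + (shift_act (shanks_poly k m) s (m + k.+1) - a0).
  rewrite (@shift_act_const_but_last _ k _ _ _ a0) //; first by rewrite addSnnS.
  by move=> j lt_jk; rewrite addSnnS s_const.
move: act10; rewrite -shift_actM mulrC shift_actM act01 => act10.
rewrite -[LHS](addKr (a0 * (shanks_poly k m.+1).[1])) -act10.
by rewrite /shanks_det /det2 /= -/a0 -/a1; ring.
Qed.

Lemma shanks_constS k : shanks_const k -> (forall m, shanks_det k m != 0) ->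
  shanks_const k.+1.
Proof.
move=> s_const w_neq0 m j; rewrite leq_eqVlt => /predU1P[->|]; last first.
  rewrite ltnS => le_jk; rewrite !shift_act_shanks_polyS -addSn.
  by rewrite !s_const.
rewrite !shift_act_shanks_polyS.
have jump i : shift_act (shanks_poly k i) s (i + k.+1) =
    shift_act (shanks_poly k i) s i - shanks_det k i.
  by rewrite -shanks_jump // addrC subrK.
(* The jump of the first term is minus [shanks_det k m.+1]; the ratio rescales the jump of the
   second term to the same value, so they cancel. *)
rewrite -addSn !jump; field; exact: w_neq0.
Qed.

Lemma shanks_constP k : (forall j, (j < k)%N -> forall m, shanks_det j m != 0) ->
  shanks_const k.
Proof.
elim: k => [_ m j|k IHk w_neq0]; first by rewrite leqn0 => /eqP ->; rewrite addn0.
by apply: shanks_constS; [apply: IHk => j /ltnW/w_neq0 | apply: w_neq0].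
Qed.

Lemma shanks_point0 m : shanks_point 0 m = (s m, 1).
Proof.
by rewrite /shanks_point /hpoint_of -[shanks_poly 0 m]polyC1 shift_actC mul1r hornerC.
Qed.

Lemma shanks_pointS k m : let r := shanks_det k m.+1 / shanks_det k m in
  shanks_point k.+1 m =
  ((shanks_point k m.+1).1 - r * (shanks_point k m).1,
   (shanks_point k m.+1).2 - r * (shanks_point k m).2).
Proof.
rewrite /shanks_point /hpoint_of /= shift_act_shanks_polyS; congr (_, _).
by rewrite shanks_polyS !hornerE.
Qed.

Lemma det2_shanks_pointl k m :
  det2 (shanks_point k m) (shanks_point k.+1 m) = shanks_det k m.
Proof. by rewrite shanks_pointS /shanks_det /det2 /=; ring. Qed.

Lemma det2_shanks_pointr k m : shanks_det k m != 0 ->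
  det2 (shanks_point k m.+1) (shanks_point k.+1 m) = shanks_det k m.+1.
Proof.
move=> w_neq0; rewrite shanks_pointS -[RHS](divfK w_neq0).
set r := (_ / _); rewrite /shanks_det /det2 /=; ring.
Qed.

Lemma det2_antisym (p q : F * F) : det2 p q = - det2 q p.
Proof. by rewrite /det2; ring. Qed.

(* The vertices two steps back; [(1, 0)] stands for the initial polygon of
   points at infinity. *)
Definition shanks_prev k m : F * F := if k is k'.+1 then shanks_point k' m.+1 else (1, 0).

(** These are the two factors of the multi-ratio that involve [X i]. For positive k both are, up to
    sign, the same determinant of the previous level, so they cancel to -1. *)
Lemma det2_shanks_prev k m : (forall j, (j < k)%N -> forall m, shanks_det j m != 0) ->
  det2 (shanks_prev k m) (shanks_point k m) != 0
  /\ det2 (shanks_point k m.+1) (shanks_prev k m) =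
     - det2 (shanks_prev k m) (shanks_point k m).
Proof.
case: k => [_|k w_neq0].
  by rewrite !shanks_point0 /det2 /= mul1r mul0r subr0 oner_neq0 mulr0 sub0r.
rewrite /shanks_prev det2_shanks_pointr ?w_neq0 //.
by rewrite [_ _ (shanks_point k m.+1)]det2_antisym det2_shanks_pointl.
Qed.

(** Stated without division, since the second coordinate may a priori vanish. *)
Lemma shanks_point_periodic_sum k m T :
    (forall l, \sum_(i < k.+1) s (l + i)%N = T) ->
    (forall j, (j < k)%N -> forall m, shanks_det j m != 0) ->
  k.+1%:R * (shanks_point k m).1 = T * (shanks_point k m).2.
Proof.
move=> s_sum /shanks_constP s_const.
transitivity (\sum_(i < k.+1) shift_act (shanks_poly k m) s (m + i)).
  under eq_bigr => i _ do rewrite (s_const _ _ (ltn_ord i)).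
  by rewrite sumr_const card_ord mulr_natl.
(* After exchanging the sums, each coefficient multiplies a full window sum, equal to [T]. *)
rewrite /= horner_coef mulr_sumr exchange_big; apply: eq_bigr => j _ /=.
rewrite -mulr_sumr expr1n mulr1 mulrC -(s_sum (m + j)%N); congr (_ * _).
by apply: eq_bigr => i _; rewrite addnAC.
Qed.

End ShanksTransform.

(** * Points of the projective line and their homogeneous coordinates *)

Section HomogeneousCoordinates.
Variable R : realType.
Implicit Types (u v : proj_line R) (p q : R * R).

Definition represents u p : Prop :=
  exists2 a, a != 0 & p = (a * hcoord u 0 0, a * hcoord u 0 1).

Lemma represents_finP x p :
  represents (p_fin x) p <-> p.2 != 0 /\ x = p.1 / p.2.
Proof.
split=> [[a a_neq0 ->]|[p2_neq0 ->]].
  by rewrite /= !mxE /= mulr1 mulrC mulKf.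
by exists p.2 => //; rewrite !mxE /= mulr1 mulrC divfK // -surjective_pairing.
Qed.

Lemma represents_inftyP p : represents p_infty p <-> p.1 != 0 /\ p.2 = 0.
Proof.
split=> [[a a_neq0 ->]|[p1_neq0 p2_eq0]]; first by rewrite /= !mxE /= mulr1 mulr0.
by exists p.1 => //; rewrite !mxE /= mulr1 mulr0 -p2_eq0 -surjective_pairing.
Qed.

Lemma represents_exists p : p != (0, 0) -> exists u, represents u p.
Proof.
rewrite [p]surjective_pairing xpair_eqE; have [p2_eq0|p2_neq0 _] := eqVneq p.2 0.
  by rewrite andbT => p1_neq0; exists p_infty; apply/represents_inftyP.
by exists (p_fin (p.1 / p.2)); apply/represents_finP.
Qed.

Lemma det2_represents_neq0 u v p q : represents u p -> represents v q ->
  (det2 p q != 0) = (pdiff u v != 0).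
Proof.
move=> [a a_neq0 ->] [b b_neq0 ->]; rewrite pdiffE.
rewrite -[RHS]andTb -(mulf_neq0 a_neq0 b_neq0) -negb_or -mulf_eq0 /det2 /=.
by congr (_ != _); ring.
Qed.

Lemma multiratio_det2 a b c d e f pa pb pc pd pe pf :
    represents a pa -> represents b pb -> represents c pc ->
    represents d pd -> represents e pe -> represents f pf ->
  multiratio a b c d e f =
  (det2 pa pb * det2 pc pd * det2 pe pf) / (det2 pb pc * det2 pd pe * det2 pf pa).
Proof.
move=> [x1 nz1 ->] [x2 nz2 ->] [x3 nz3 ->] [x4 nz4 ->] [x5 nz5 ->] [x6 nz6 ->].
(* The product of all six scalars is the common factor of numerator and denominator. *)
have nz : x1 * x2 * x3 * x4 * x5 * x6 != 0 by rewrite !mulf_neq0.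
rewrite /multiratio !pdiffE -[LHS]mul1r -(divff nz) mulf_div /det2 /=.
by congr (_ / _); ring.
Qed.

Lemma multiratio_neq0 (a b c d e f : proj_line R) :
  multiratio a b c d e f != 0 -> pdiff e f != 0.
Proof. by rewrite /multiratio !mulf_eq0 !negb_or => /andP[/andP[]]. Qed.

End HomogeneousCoordinates.

(** * Identification of the pentagram iterates with the Shanks points *)

Section PentagramIsShanks.
Variables (R : realType) (n' : nat) (B : 'I_n'.+1 -> R).
Local Notation n := n'.+1.

Definition cyc (m : nat) : 'I_n := Ordinal (ltn_pmod m (ltn0Sn n')).

Lemma ordS_cyc m : ordS (cyc m) = cyc m.+1.
Proof. by apply: val_inj; rewrite /= -addn1 modnDml addn1. Qed.

Lemma ord_pred_cyc m : ord_pred (cyc m.+1) = cyc m.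
Proof. by rewrite -ordS_cyc ordSK. Qed.

Lemma cyc_surj k (i : 'I_n) : exists m, i = cyc (m + k).
Proof.
(* Adding [k * n'] replaces subtracting [k], as their sum is [k * n]. *)
exists (i + k * n')%N; apply: val_inj.
by rewrite /= -addnA -mulnSr addnC modnMDl modn_small.
Qed.

Let s (l : nat) : R := B (cyc l).

Lemma sum_over_period l : \sum_(i < n) s (l + i) = \sum_(i < n) B i.
Proof.
elim: l => [|l <-].
  by apply: eq_bigr => i _; congr B; apply: val_inj; rewrite /= add0n modn_small.
rewrite big_ord_recr [RHS]big_ord_recl addrC /= addn0; congr (_ + _).
  by apply: eq_bigr => i _; rewrite addSnnS.
by congr B; apply: val_inj; rewrite /= addSnnS modnDr.
Qed.

Definition shanks_polygons k (XY : polygon R n * polygon R n) : Prop :=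
  [/\ forall m, represents (XY.1 (cyc (m + k))) (shanks_prev s k m),
      forall m, represents (XY.2 (cyc (m + k))) (shanks_point s k m)
    & forall j, (j < k)%N -> forall m, shanks_det s j m != 0].

Lemma shanks_polygons0 : shanks_polygons 0 (axis_aligned B).
Proof.
split=> // m; rewrite /axis_aligned !ffunE.
  by apply/represents_inftyP; rewrite oner_neq0.
apply/represents_finP; by rewrite shanks_point0 /= divr1 oner_neq0 /s addn0.
Qed.

Lemma shanks_polygonsS k XY XY' : shanks_polygons k XY ->
  lower_pentagram XY = Some XY' -> shanks_polygons k.+1 XY'.
Proof.
case: XY XY' => [X Y] [C D] [/= repX repY w_neq0] /lower_pentagramP[-> uD].
have wk_neq0 m : shanks_det s k m != 0.
  have /= [ptD _] := uD (cyc (m + k)).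
  rewrite /shanks_det (det2_represents_neq0 (repY m) (repY m.+1)) addSn -ordS_cyc.
  (* A multi-ratio equal to -1 is nonzero, hence so is its numerator factor from consecutive
     vertices of [Y]: definedness of the map yields nondegeneracy. *)
  have := oppr_eq0 (1 : R); rewrite oner_eq0 -ptD => /negbT.
  exact: multiratio_neq0.
have w_neq0' j : (j < k.+1)%N -> forall m, shanks_det s j m != 0.
  by rewrite ltnS leq_eqVlt => /predU1P[->|/w_neq0].
split=> // m /=; first by rewrite -addSnnS.
have [|z repz] := @represents_exists _ (shanks_point s k.+1 m).
  apply: contraNneq (wk_neq0 m) => Pk_eq0.
  by rewrite -det2_shanks_pointl Pk_eq0 /det2 !mulr0 subr0.
have [u_neq0 eq_u] := @det2_shanks_prev _ s k m.+1 w_neq0.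
(* Uniqueness of the solution identifies [z] with the new vertex once [z] solves the equation. *)
suff ptz : pentagram_point X Y (cyc (m + k.+1)) z.
  by rewrite ((uD _).2 z ptz).
rewrite /pentagram_point addnS ord_pred_cyc ordS_cyc -!addSn.
rewrite (multiratio_det2 (repX _) (repY _) (repY _) repz (repY _) (repY _)).
rewrite eq_u det2_shanks_pointl.
rewrite [det2 (shanks_point s k m.+1) (shanks_point s k m)]det2_antisym.
rewrite [det2 (shanks_point s k.+1 m) _]det2_antisym det2_shanks_pointr //.
rewrite -!/(shanks_det _ _ _); field.
by rewrite u_neq0 !wk_neq0.
Qed.

Lemma shanks_polygons_iter k XY :
  lower_pentagram_iter k (axis_aligned B) = Some XY -> shanks_polygons k XY.
Proof.
elim: k XY => [|k IHk] XY; first by case=> <-; exact: shanks_polygons0.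
rewrite /lower_pentagram_iter iterS -/(lower_pentagram_iter k _).
by case eq_k: lower_pentagram_iter => [XY0|//] /(shanks_polygonsS (IHk _ eq_k)).
Qed.

Lemma lower_pentagram_iter_center C D :
  lower_pentagram_iter n' (axis_aligned B) = Some (C, D) ->
  forall i, D i = p_fin (center_of_mass B).
Proof.
move=> /shanks_polygons_iter[/= _ repD w_neq0] i.
have [m ->] := cyc_surj n' i.
(* After [n'] steps the range of constancy has n positions, exactly one period. *)
have := shanks_point_periodic_sum m sum_over_period w_neq0.
move: (repD m); case: (D _) => [x|].
  move=> /represents_finP[P2_neq0 ->] sumP; congr Some.
  apply: (mulfI (_ : n%:R != 0)); first by rewrite pnatr_eq0.
  by rewrite mulrA sumP mulfK // /center_of_mass mulVKf // pnatr_eq0.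
(* At infinity the second coordinate is 0, so the identity would force the first to vanish too. *)
move=> /represents_inftyP[P1_neq0 ->] /eqP.
by rewrite mulr0 mulf_eq0 pnatr_eq0 (negPf P1_neq0).
Qed.

End PentagramIsShanks.

Lemma zariski_open_setT (R : realType) (n : nat) :
  zariski_open (@setT ('I_n -> R)).
Proof.
exists [set p | p = 1]%classic; rewrite setCT; apply/seteqP; split=> // x /=.
by move=> /(_ 1 erefl)/eqP; rewrite meval1 oner_eq0.
Qed.

Theorem theorem4p1 (R : realType) (n : nat) (n_gt0 : (0 < n)%N) :
  generically (fun B : 'I_n -> R =>
    forall C D : polygon R n,
      lower_pentagram_iter n.-1 (axis_aligned B) = Some (C, D) ->
      forall i : 'I_n, D i = p_fin (center_of_mass B)).
Proof.
(* All of the space serves as the open set: nondegeneracy is drawn from the definedness of the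
   iterate at each [B]. *)
exists setT; split; [exact: zariski_open_setT | by exists (fun=> 0) |].
case: n n_gt0 => // n' _ B _ C D; exact: lower_pentagram_iter_center.
Qed.
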